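(* Every typed term of the simply typed symmetric $\lambda\mu$-calculus is strongly normalizing for the $\beta\mu\mu'$-reduction: if $\Gamma\vdash M:A$ for some context $\Gamma$ and some type $A$, then there is no infinite sequence of $\beta\mu\mu'$-reduction steps starting from $M$.
   Context: $\lambda\mu$-terms are generated by the grammar $t ::= x \mid \lambda x\, t \mid (t\; t) \mid \mu\alpha\, t \mid (\alpha\; t)$, where $x,y,\dots$ are $\lambda$-variables and $\alpha,\beta,\dots$ are $\mu$-variables (two disjoint infinite sets); $\lambda x$ and $\mu\alpha$ are binders, terms are considered up to renaming of bound variables and substitutions are capture-avoiding. $M[\alpha=_rN]$ is obtained from $M$ by replacing (recursively) each sub-term $(\alpha\; U)$, $\alpha$ free, by $(\alpha\; (U\; N))$; $M[\alpha=_lN]$ is obtained by replacing (recursively) each such sub-term by $(\alpha\; (N\; U))$. The $\beta\mu\mu'$-reduction is the closure under all term constructors of the rules $(\lambda x M\; N)\triangleright M[x:=N]$ (rule $\beta$), $(\mu\alpha M\; N)\triangleright \mu\alpha\, M[\alpha=_rN]$ (rule $\mu$) and $(M\;\mu\alpha N)\triangleright\mu\alpha\, N[\alpha=_lM]$ (rule $\mu'$). Types are built from atomic formulas and the constant $\perp$ with the connective $\rightarrow$; $\neg A$ abbreviates $A\rightarrow\perp$. A context $\Gamma$ is a set of declarations $x:A$ and $\alpha:\neg A$ ($x$ a $\lambda$-variable, $\alpha$ a $\mu$-variable). The typing rules are: $\Gamma,x:A\vdash x:A$; from $\Gamma,x:A\vdash M:B$ infer $\Gamma\vdash\lambda x M:A\rightarrow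 B$; from $\Gamma\vdash M:A\rightarrow B$ and $\Gamma\vdash N:A$ infer $\Gamma\vdash(M\;N):B$; from $\Gamma,\alpha:\neg A\vdash M:\perp$ infer $\Gamma\vdash\mu\alpha M:A$; from $\Gamma,\alpha:\neg A\vdash M:A$ infer $\Gamma,\alpha:\neg A\vdash(\alpha\;M):\perp$. *)

(* Defs.v *)
From Stdlib Require Import Arith.

Set Implicit Arguments.

(** Terms up to renaming of bound variables: de Bruijn indices, with two
    independent index spaces.  [Lam] binds index 0 of the lambda-variables only,
    [Mu] binds index 0 of the mu-variables only; [Nam a t] is [(alpha t)]. *)
Inductive term : Type :=
| Var (x : nat)
| Lam (t : term)
| App (t u : term)
| Mu (t : term)
| Nam (a : nat) (t : term).

Definition scons (T : Type) (a : T) (s : nat -> T) (n : nat) : T :=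
  match n with
  | 0 => a
  | S m => s m
  end.

Definition upren (r : nat -> nat) : nat -> nat := scons 0 (fun n => S (r n)).

(** [r] renames the lambda-variables, [s] the mu-variables. *)
Fixpoint ren (r s : nat -> nat) (t : term) : term :=
  match t with
  | Var x => Var (r x)
  | Lam t => Lam (ren (upren r) s t)
  | App t u => App (ren r s t) (ren r s u)
  | Mu t => Mu (ren r (upren s) t)
  | Nam a t => Nam (s a) (ren r s t)
  end.

Definition shift_lam : term -> term := ren S (fun a => a).
Definition shift_mu : term -> term := ren (fun x => x) S.

(** Simultaneous substitution for the lambda-variables. *)
Fixpoint subst (f : nat -> term) (t : term) : term :=
  match t with
  | Var x => f x
  | Lam t => Lam (subst (scons (Var 0) (fun x => shift_lam (f x))) t)
  | App t u => App (subst f t) (subst f u)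
  | Mu t => Mu (subst (fun x => shift_mu (f x)) t)
  | Nam a t => Nam a (subst f t)
  end.

(** [M[x:=N]] where [x] is index 0 of [M]; the binder of [x] disappears, so the
    other lambda-variables are lowered by one. *)
Definition subst0 (N M : term) : term := subst (scons N Var) M.

(** [M[a =_r N]]: every [(a U)] becomes [(a (U N))].  The variable [a] is not
    eliminated, hence no mu-index is lowered. *)
Fixpoint msubst_r (a : nat) (N M : term) : term :=
  match M with
  | Var x => Var x
  | Lam t => Lam (msubst_r a (shift_lam N) t)
  | App t u => App (msubst_r a N t) (msubst_r a N u)
  | Mu t => Mu (msubst_r (S a) (shift_mu N) t)
  | Nam b t =>
      if Nat.eqb b a then Nam b (App (msubst_r a N t) N)
      else Nam b (msubst_r a N t)
  end.

(** [M[a =_l N]]: every [(a U)] becomes [(a (N U))]. *)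
Fixpoint msubst_l (a : nat) (N M : term) : term :=
  match M with
  | Var x => Var x
  | Lam t => Lam (msubst_l a (shift_lam N) t)
  | App t u => App (msubst_l a N t) (msubst_l a N u)
  | Mu t => Mu (msubst_l (S a) (shift_mu N) t)
  | Nam b t =>
      if Nat.eqb b a then Nam b (App N (msubst_l a N t))
      else Nam b (msubst_l a N t)
  end.

(** In [red_mu] and [red_mu'] the argument moves under the binder [Mu], whence
    the shift. *)
Inductive red : term -> term -> Prop :=
| red_beta M N : red (App (Lam M) N) (subst0 N M)
| red_mu M N : red (App (Mu M) N) (Mu (msubst_r 0 (shift_mu N) M))
| red_mu' M N : red (App M (Mu N)) (Mu (msubst_l 0 (shift_mu M) N))
| red_Lam M M' : red M M' -> red (Lam M) (Lam M')
| red_App_l M M' N : red M M' -> red (App M N) (App M' N)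
| red_App_r M N N' : red N N' -> red (App M N) (App M N')
| red_Mu M M' : red M M' -> red (Mu M) (Mu M')
| red_Nam a M M' : red M M' -> red (Nam a M) (Nam a M').

Inductive ty (Atom : Type) : Type :=
| Atm (p : Atom)
| Bot
| Arr (A B : ty Atom).

Arguments Bot {Atom}.

(** A context is a pair of partial maps: [G x = Some A] is the declaration
    [x : A], and [D a = Some A] is the declaration [a : Arr A Bot] (the negation
    of [A]), so that mu-variables are only ever declared with a negated type. *)
Definition ctx (Atom : Type) : Type := nat -> option (ty Atom).

Inductive typed (Atom : Type) (G D : ctx Atom) : term -> ty Atom -> Prop :=
| typed_Var x A : G x = Some A -> typed G D (Var x) A
| typed_Lam M A B : typed (scons (Some A) G) D M B -> typed G D (Lam M) (Arr A B)
| typed_App M N A B :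
    typed G D M (Arr A B) -> typed G D N A -> typed G D (App M N) B
| typed_Mu M A : typed G (scons (Some A) D) M Bot -> typed G D (Mu M) A
| typed_Nam a M A : D a = Some A -> typed G D M A -> typed G D (Nam a M) Bot.

(* Main.v *)
(** Symmetric reducibility candidates in the style of Barbanera and Berardi.  To
    each type [A] correspond a set [T_A] of terms and a set [K_A] of applicative
    contexts [H], with [H[t]] strongly normalizing for [t] in [T_A] and [H] in
    [K_A].  A term [mu a. N] is in [T_A] when [N[a := H]] is strongly
    normalizing for all [H] in [K_A].  Since [K_A] must contain the contexts
    [H[(s [])]], which test elements of [T_A], the two sets are given by a
    fixpoint of the composite of two antimonotone maps.

    The point is the condition put on [s] in [H[(s [])]].  Asking that [H[(s t)]]
    be strongly normalizing for all [t] in [T_A] is circular, because of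
    the redex formed when [t] is a [mu]; and the type of [(s t)] may be larger
    than [A].  Instead [s] is required to lie in the arrow of [T_A] and some
    candidate [(X, Y)], the quantification being impredicative: this constrains
    only the abstractions and the [mu]s that [s] reduces to.  It still implies
    that [(s t)] is in [X], the redexes formed by [t] being handled by the
    membership of [t] in [T_A]. *)

Require Import Defs.
From Stdlib Require Import List Relations.
Import ListNotations.

Set Implicit Arguments.

(** * Applicative contexts and simultaneous instantiation *)

Inductive frame : Type :=
| AppTo (u : term)
| AppOf (s : term).

Definition fmap (h : term -> term) (F : frame) : frame :=
  match F with
  | AppTo u => AppTo (h u)
  | AppOf s => AppOf (h s)
  end.

Definition fill (F : frame) (t : term) : term :=
  match F with
  | AppTo u => App t u
  | AppOf s => App s t
  end.

(** The innermost frame comes first. *)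
Definition plug (H : list frame) (t : term) : term :=
  fold_left (fun t F => fill F t) H t.

(** A mu-variable [a] is instantiated by [(b, H)], turning [(a U)] into
    [(b H[U])]. *)
Definition cont : Type := (nat * list frame)%type.

Definition cont_map (h : term -> term) (s : nat -> nat) (c : cont) : cont :=
  (s (fst c), map (fmap h) (snd c)).

Definition up_lam (f : nat -> term) : nat -> term :=
  scons (Var 0) (fun x => shift_lam (f x)).
Definition cup_lam (g : nat -> cont) (a : nat) : cont :=
  cont_map shift_lam (fun b => b) (g a).
Definition up_mu (f : nat -> term) (x : nat) : term := shift_mu (f x).
Definition cup_mu (g : nat -> cont) : nat -> cont :=
  scons (0, []) (fun a => cont_map shift_mu S (g a)).

(** Renaming, [subst], [msubst_r] and [msubst_l] are all instances of this operation, so one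
    composition law, [inst_inst], replaces separate commutation lemmas. *)
Fixpoint inst (f : nat -> term) (g : nat -> cont) (t : term) : term :=
  match t with
  | Var x => f x
  | Lam t => Lam (inst (up_lam f) (cup_lam g) t)
  | App t u => App (inst f g t) (inst f g u)
  | Mu t => Mu (inst (up_mu f) (cup_mu g) t)
  | Nam a t => Nam (fst (g a)) (plug (snd (g a)) (inst f g t))
  end.

Definition cid (a : nat) : cont := (a, []).

(** * The calculus of instantiations *)

Lemma fmap_ext h h' F : (forall t, h t = h' t) -> fmap h F = fmap h' F.
Proof. destruct F; simpl; intros E; rewrite E; reflexivity. Qed.

Lemma fmap_fmap h h' F : fmap h (fmap h' F) = fmap (fun t => h (h' t)) F.
Proof. destruct F; reflexivity. Qed.

Lemma fmap_id h F : (forall t, h t = t) -> fmap h F = F.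
Proof. destruct F; simpl; intros E; rewrite E; reflexivity. Qed.

Lemma map_fmap_ext h h' H :
  (forall t, h t = h' t) -> map (fmap h) H = map (fmap h') H.
Proof. intros E; apply map_ext; intros F; apply fmap_ext, E. Qed.

Lemma map_fmap_fmap h h' H :
  map (fmap h) (map (fmap h') H) = map (fmap (fun t => h (h' t))) H.
Proof. rewrite map_map; apply map_ext; intros F; apply fmap_fmap. Qed.

Lemma map_fmap_id h H : (forall t, h t = t) -> map (fmap h) H = H.
Proof.
  intros E; rewrite <- (map_id H) at 2; apply map_ext; intros F.
  apply fmap_id, E.
Qed.

Lemma plug_app H H' t : plug (H ++ H') t = plug H' (plug H t).
Proof. apply fold_left_app. Qed.

Lemma ren_ext r r' s s' t :
  (forall x, r x = r' x) -> (forall a, s a = s' a) -> ren r s t = ren r' s' t.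
Proof.
  revert r r' s s'.
  induction t as [x | t IH | t IHt u IHu | t IH | a t IH]; simpl;
    intros r r' s s' Er Es; f_equal; auto.
  - apply IH; auto. intros [|x]; simpl; auto.
  - apply IH; auto. intros [|x]; simpl; auto.
Qed.

Lemma inst_ext f f' g g' t :
  (forall x, f x = f' x) -> (forall a, g a = g' a) ->
  inst f g t = inst f' g' t.
Proof.
  revert f f' g g'.
  induction t as [x | t IH | t IHt u IHu | t IH | a t IH]; simpl;
    intros f f' g g' Ef Eg; auto.
  - f_equal; apply IH.
    + intros [|x]; simpl; auto. rewrite Ef; auto.
    + intros a; unfold cup_lam; rewrite Eg; auto.
  - f_equal; auto.
  - f_equal; apply IH.
    + intros x; unfold up_mu; rewrite Ef; auto.
    + intros [|a]; simpl; auto. rewrite Eg; auto.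
  - rewrite Eg, (IH f f' g g'); auto.
Qed.

Lemma ren_inst_eq r s t :
  ren r s t = inst (fun x => Var (r x)) (fun a => (s a, [])) t.
Proof.
  revert r s.
  induction t as [x | t IH | t IHt u IHu | t IH | a t IH]; simpl;
    intros r s; f_equal; auto; rewrite IH; apply inst_ext; auto;
    intros [|x]; reflexivity.
Qed.

Lemma inst_ren f g r s t :
  inst f g (ren r s t) = inst (fun x => f (r x)) (fun a => g (s a)) t.
Proof.
  revert f g r s.
  induction t as [x | t IH | t IHt u IHu | t IH | a t IH]; simpl;
    intros f g r s; f_equal; auto.
  - rewrite IH; apply inst_ext; auto. intros [|x]; reflexivity.
  - rewrite IH; apply inst_ext; auto. intros [|x]; reflexivity.
  - rewrite IH; reflexivity.
Qed.

Lemma ren_ren r s r' s' t :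
  ren r s (ren r' s' t) = ren (fun x => r (r' x)) (fun a => s (s' a)) t.
Proof. rewrite (ren_inst_eq r s), inst_ren; symmetry; apply ren_inst_eq. Qed.

Lemma ren_plug r s H t :
  ren r s (plug H t) = plug (map (fmap (ren r s)) H) (ren r s t).
Proof.
  revert t; induction H as [|[u|u] H IH]; simpl; intros t; auto;
    apply (IH (App _ _)).
Qed.

Lemma inst_plug f g H t :
  inst f g (plug H t) = plug (map (fmap (inst f g)) H) (inst f g t).
Proof.
  revert t; induction H as [|[u|u] H IH]; simpl; intros t; auto;
    apply (IH (App _ _)).
Qed.

Lemma ren_inst r s f g t :
  ren r s (inst f g t) =
  inst (fun x => ren r s (f x)) (fun a => cont_map (ren r s) s (g a)) t.
Proof.
  revert f g r s.
  induction t as [x | t IH | t IHt u IHu | t IH | a t IH]; simpl;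
    intros f g r s; f_equal; auto.
  - rewrite IH; apply inst_ext.
    + intros [|x]; simpl; auto. unfold shift_lam; rewrite !ren_ren.
      reflexivity.
    + intros a; unfold cup_lam, cont_map; simpl; f_equal.
      rewrite !map_fmap_fmap; apply map_fmap_ext; intros u.
      unfold shift_lam; rewrite !ren_ren; reflexivity.
  - rewrite IH; apply inst_ext.
    + intros x; unfold up_mu, shift_mu; rewrite !ren_ren. reflexivity.
    + intros [|a]; simpl; auto. unfold cont_map; simpl; f_equal.
      rewrite !map_fmap_fmap; apply map_fmap_ext; intros u.
      unfold shift_mu; rewrite !ren_ren; reflexivity.
  - rewrite ren_plug, IH. reflexivity.
Qed.

(** The frames of [c] come first because they lie closer to the hole. *)
Definition ccomp (f : nat -> term) (g : nat -> cont) (c : cont) : cont :=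
  (fst (g (fst c)), map (fmap (inst f g)) (snd c) ++ snd (g (fst c))).

Lemma inst_inst f g f' g' t :
  inst f g (inst f' g' t) =
  inst (fun x => inst f g (f' x)) (fun a => ccomp f g (g' a)) t.
Proof.
  revert f g f' g'.
  induction t as [x | t IH | t IHt u IHu | t IH | a t IH]; simpl;
    intros f g f' g'; f_equal; auto.
  - rewrite IH; apply inst_ext.
    + intros [|x]; simpl; auto. unfold shift_lam.
      rewrite inst_ren, ren_inst. apply inst_ext; reflexivity.
    + intros a; unfold cup_lam, ccomp, cont_map; simpl; f_equal.
      rewrite map_app, !map_fmap_fmap; f_equal.
      apply map_fmap_ext; intros u; unfold shift_lam.
      rewrite inst_ren, ren_inst. apply inst_ext; reflexivity.
  - rewrite IH; apply inst_ext.
    + intros x; unfold up_mu, shift_mu.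
      rewrite inst_ren, ren_inst. apply inst_ext; reflexivity.
    + intros [|a]; simpl; auto. unfold ccomp, cont_map; simpl; f_equal.
      rewrite map_app, !map_fmap_fmap; f_equal.
      apply map_fmap_ext; intros u; unfold shift_mu.
      rewrite inst_ren, ren_inst. apply inst_ext; reflexivity.
  - rewrite inst_plug, plug_app, IH. reflexivity.
Qed.

Lemma inst_id t : inst Var cid t = t.
Proof.
  rewrite <- (ren_inst_eq (fun x => x) (fun a => a)).
  induction t as [x | t IH | t IHt u IHu | t IH | a t IH]; simpl; f_equal;
    auto; rewrite <- IH at 2; apply ren_ext; auto; intros [|x]; reflexivity.
Qed.

Lemma subst_inst f t : subst f t = inst f cid t.
Proof.
  revert f.
  induction t as [x | t IH | t IHt u IHu | t IH | a t IH]; simpl;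
    intros f; f_equal; auto; rewrite IH; apply inst_ext; auto.
  intros [|a]; reflexivity.
Qed.

(** Taking an arbitrary frame gives the rules mu and mu' a common treatment. *)
Definition cupd (a : nat) (F : frame) (b : nat) : cont :=
  (b, if Nat.eqb b a then [F] else []).

Lemma msubst_r_inst a N t : msubst_r a N t = inst Var (cupd a (AppTo N)) t.
Proof.
  revert a N.
  induction t as [x | t IH | t IHt u IHu | t IH | b t IH]; simpl;
    intros a N; f_equal; auto.
  - rewrite IH; apply inst_ext.
    + intros [|x]; reflexivity.
    + intros b; unfold cup_lam, cupd, cont_map; simpl.
      destruct (Nat.eqb b a); reflexivity.
  - rewrite IH; apply inst_ext; auto.
    intros [|b]; unfold cupd, cont_map; simpl; auto.
    destruct (Nat.eqb b a); reflexivity.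
  - rewrite IH. destruct (Nat.eqb b a); reflexivity.
Qed.

Lemma msubst_l_inst a N t : msubst_l a N t = inst Var (cupd a (AppOf N)) t.
Proof.
  revert a N.
  induction t as [x | t IH | t IHt u IHu | t IH | b t IH]; simpl;
    intros a N; f_equal; auto.
  - rewrite IH; apply inst_ext.
    + intros [|x]; reflexivity.
    + intros b; unfold cup_lam, cupd, cont_map; simpl.
      destruct (Nat.eqb b a); reflexivity.
  - rewrite IH; apply inst_ext; auto.
    intros [|b]; unfold cupd, cont_map; simpl; auto.
    destruct (Nat.eqb b a); reflexivity.
  - rewrite IH. destruct (Nat.eqb b a); reflexivity.
Qed.

Lemma cont_map_id h c : (forall t, h t = t) -> cont_map h (fun b => b) c = c.
Proof.
  intros E; destruct c as [b H]; unfold cont_map; simpl.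
  rewrite map_fmap_id by exact E; reflexivity.
Qed.

Lemma inst_shift_lam u f g t :
  inst (scons u f) g (shift_lam t) = inst f g t.
Proof. unfold shift_lam; rewrite inst_ren; reflexivity. Qed.

Lemma inst_shift_mu c f g t :
  inst f (scons c g) (shift_mu t) = inst f g t.
Proof. unfold shift_mu; rewrite inst_ren; reflexivity. Qed.

Lemma subst0_inst_up f g u M :
  subst0 u (inst (up_lam f) (cup_lam g) M) = inst (scons u f) g M.
Proof.
  unfold subst0; rewrite subst_inst, inst_inst; apply inst_ext.
  - intros [|x]; simpl; auto. rewrite inst_shift_lam; apply inst_id.
  - intros a; unfold ccomp; simpl. rewrite app_nil_r, map_fmap_fmap.
    apply (cont_map_id _ (g a)); intros t.
    rewrite inst_shift_lam; apply inst_id.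
Qed.

Lemma inst_subst0 f g N M :
  inst f g (subst0 N M) = subst0 (inst f g N) (inst (up_lam f) (cup_lam g) M).
Proof.
  rewrite subst0_inst_up; unfold subst0; rewrite subst_inst, inst_inst.
  apply inst_ext.
  - intros [|x]; reflexivity.
  - intros a; unfold ccomp; simpl; destruct (g a); reflexivity.
Qed.

Lemma inst_cupd f g F M :
  inst (up_mu f) (cup_mu g) (inst Var (cupd 0 (fmap shift_mu F)) M) =
  inst Var (cupd 0 (fmap shift_mu (fmap (inst f g) F)))
    (inst (up_mu f) (cup_mu g) M).
Proof.
  rewrite !inst_inst; apply inst_ext.
  - intros x; simpl; unfold up_mu, shift_mu. rewrite inst_ren.
    apply ren_inst_eq.
  - intros [|a]; unfold ccomp, cont_map; simpl.
    + f_equal; f_equal. rewrite !fmap_fmap; apply fmap_ext; intros t.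
      unfold shift_mu; rewrite inst_ren, ren_inst. apply inst_ext; reflexivity.
    + f_equal. rewrite app_nil_r, map_fmap_fmap; apply map_fmap_ext; intros t.
      unfold shift_mu; rewrite inst_ren. apply ren_inst_eq.
Qed.

(** * Reduction and strong normalization *)

Lemma red_plug H t t' : red t t' -> red (plug H t) (plug H t').
Proof.
  revert t t'; induction H as [|[u|u] H IH]; simpl; intros t t' R; auto;
    apply IH; simpl; constructor; exact R.
Qed.

Lemma red_inst f g M M' : red M M' -> red (inst f g M) (inst f g M').
Proof.
  intros R; revert f g; induction R; intros f g; simpl;
    try (constructor; auto; fail).
  - rewrite inst_subst0. constructor.
  - rewrite msubst_r_inst.
    change (AppTo (shift_mu N)) with (fmap shift_mu (AppTo N)).
    rewrite inst_cupd; cbn [fmap]; rewrite <- msubst_r_inst. constructor.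
  - rewrite msubst_l_inst.
    change (AppOf (shift_mu M)) with (fmap shift_mu (AppOf M)).
    rewrite inst_cupd; cbn [fmap]; rewrite <- msubst_l_inst. constructor.
  - constructor. apply red_plug; auto.
Qed.

Definition reds : term -> term -> Prop := clos_refl_trans_1n term red.
Definition SN : term -> Prop := Acc (fun t' t => red t t').

Lemma reds_inst f g M M' : reds M M' -> reds (inst f g M) (inst f g M').
Proof.
  induction 1 as [|M M1 M' R _ IH]; [constructor|].
  econstructor; [apply red_inst, R | exact IH].
Qed.

Lemma reds_Lam M t : reds (Lam M) t -> exists M', t = Lam M' /\ reds M M'.
Proof.
  intros R; remember (Lam M) as l eqn:E; revert M E.
  induction R as [|l l1 t R _ IH]; intros M ->.
  - exists M; split; [reflexivity | constructor].
  - inversion R; subst. destruct (IH _ eq_refl) as (M2 & -> & R2).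
    exists M2; split; [reflexivity | econstructor; eassumption].
Qed.

Lemma reds_Mu M t : reds (Mu M) t -> exists M', t = Mu M' /\ reds M M'.
Proof.
  intros R; remember (Mu M) as l eqn:E; revert M E.
  induction R as [|l l1 t R _ IH]; intros M ->.
  - exists M; split; [reflexivity | constructor].
  - inversion R; subst. destruct (IH _ eq_refl) as (M2 & -> & R2).
    exists M2; split; [reflexivity | econstructor; eassumption].
Qed.

Lemma reds_Nam a M t : reds (Nam a M) t -> exists M', t = Nam a M'.
Proof.
  intros R; remember (Nam a M) as l eqn:E; revert M E.
  induction R as [|l l1 t R _ IH]; intros M ->; [eauto|].
  inversion R; subst; eauto.
Qed.

Lemma reds_Var x t : reds (Var x) t -> t = Var x.
Proof.
  intros R; inversion R as [|? ? R']; subst; [reflexivity | inversion R'].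
Qed.

Lemma SN_reds M M' : SN M -> reds M M' -> SN M'.
Proof. intros S R; induction R; auto. apply IHR, S; assumption. Qed.

(** Instantiation maps each step to exactly one step, so strong normalization is reflected. *)
Lemma SN_inst_inv f g M : SN (inst f g M) -> SN M.
Proof.
  intros S; remember (inst f g M) as t eqn:E; revert M E.
  induction S as [t _ IH]; intros M ->; constructor; intros M' R.
  eapply IH; [apply red_inst, R | reflexivity].
Qed.

Lemma SN_Lam M : SN M -> SN (Lam M).
Proof.
  induction 1 as [M _ IH]; constructor; intros t R; inversion R; subst;
    apply IH; assumption.
Qed.

Lemma SN_Mu M : SN M -> SN (Mu M).
Proof.
  induction 1 as [M _ IH]; constructor; intros t R; inversion R; subst;
    apply IH; assumption.
Qed.

Lemma SN_Nam a M : SN M -> SN (Nam a M).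
Proof.
  induction 1 as [M _ IH]; constructor; intros t R; inversion R; subst;
    apply IH; assumption.
Qed.

(** * Symmetric candidates and their greatest fixpoint *)

(** The binder of index 0 is removed by identifying it with the free variable 0;
    this identification is harmless for strong normalization and spares any
    closure under renaming of the candidates below. *)
Definition minst (H : list frame) (N : term) : term :=
  inst Var (scons (0, H) cid) N.

Lemma minst_inst_up f g H M :
  minst H (inst (up_mu f) (cup_mu g) M) = inst f (scons (0, H) g) M.
Proof.
  unfold minst; rewrite inst_inst; apply inst_ext.
  - intros x; unfold up_mu. rewrite inst_shift_mu; apply inst_id.
  - intros [|a]; unfold ccomp; simpl; auto. rewrite app_nil_r, map_fmap_fmap.
    apply (cont_map_id _ (g a)); intros t.
    rewrite inst_shift_mu; apply inst_id.
Qed.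

(** The frame absorbed by a mu or mu' step becomes the innermost one: testing the reduct against [H]
    amounts to testing the original body against [F :: H]. *)
Lemma minst_cupd H F N :
  minst H (inst Var (cupd 0 (fmap shift_mu F)) N) = minst (F :: H) N.
Proof.
  unfold minst; rewrite inst_inst; apply inst_ext; auto.
  intros [|a]; unfold ccomp; simpl; auto. f_equal; f_equal.
  rewrite fmap_fmap; apply fmap_id; intros t.
  rewrite inst_shift_mu; apply inst_id.
Qed.

(** Applications, redexes included, play the part of neutral terms. *)
Record cand (X : term -> Prop) (Y : list frame -> Prop) : Prop := {
  cand_plug : forall t H, X t -> Y H -> SN (plug H t);
  cand_App : forall p q, (forall t, red (App p q) t -> X t) -> X (App p q);
  cand_Mu : forall N, (forall H, Y H -> SN (minst H N)) -> X (Mu N) }.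

Definition arrow (T X : term -> Prop) (Y : list frame -> Prop) (s : term) :=
  SN s /\
  (forall u P, T u -> reds s (Lam P) -> X (subst0 u P)) /\
  (forall u N H, T u -> reds s (Mu N) -> Y H -> SN (minst (AppTo u :: H) N)).

(** For a left frame [(s [])], the type of [(s t)] is unrelated to that of the
    hole, so it is replaced by an arbitrary candidate. *)
Definition left_ctx (T : term -> Prop) (H : list frame) : Prop :=
  exists s H' X Y,
    H = AppOf s :: H' /\ cand X Y /\ Y H' /\ arrow T X Y s.

(** [Z] here and [L] in [phi] are the type-specific parameters: elimination contexts and admissible
    bodies of abstractions. *)
Definition psi (Z : list frame -> Prop) (T : term -> Prop) (H : list frame) :=
  H = [] \/ Z H \/ left_ctx T H.

Definition phi (L : term -> Prop) (K : list frame -> Prop) (t : term) :=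
  SN t /\
  (forall P, reds t (Lam P) -> L P) /\
  (forall N H, reds t (Mu N) -> K H -> SN (minst H N)).

(** [psi Z] and [phi L] are antimonotone, so [T |-> phi L (psi Z T)] is
    monotone. *)
Definition gfp (L : term -> Prop) (Z : list frame -> Prop) (t : term) : Prop :=
  exists S : term -> Prop,
    S t /\ forall t', S t' -> phi L (psi Z S) t'.

Lemma arrow_anti (T T' X : term -> Prop) (Y : list frame -> Prop) s :
  (forall t, T t -> T' t) -> arrow T' X Y s -> arrow T X Y s.
Proof. intros E (S & HL & HM); split; [exact S | split]; eauto. Qed.

Lemma psi_anti Z (T T' : term -> Prop) H :
  (forall t, T t -> T' t) -> psi Z T' H -> psi Z T H.
Proof.
  intros E [-> | [HZ | (s & H' & X & Y & -> & C & HY & A)]].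
  - left; reflexivity.
  - right; left; exact HZ.
  - right; right; exists s, H', X, Y.
    repeat (split; [assumption || reflexivity|]).
    eapply arrow_anti; eassumption.
Qed.

Lemma phi_anti L (K K' : list frame -> Prop) t :
  (forall H, K H -> K' H) -> phi L K' t -> phi L K t.
Proof. intros E (S & HL & HM); split; [exact S | split]; eauto. Qed.

Lemma gfp_unfold L Z t : gfp L Z t -> phi L (psi Z (gfp L Z)) t.
Proof.
  intros (S & St & HS). eapply phi_anti; [|apply HS, St].
  intros H; apply psi_anti. intros u Su; exists S; auto.
Qed.

(** By monotonicity, the operator applied to [gfp L Z] is again a post-fixed point, hence contained
    in [gfp L Z]. *)
Lemma gfp_fold L Z t : phi L (psi Z (gfp L Z)) t -> gfp L Z t.
Proof.
  intros Ht. exists (phi L (psi Z (gfp L Z))); split; [exact Ht|].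
  intros u Hu. eapply phi_anti; [|exact Hu].
  intros H; apply psi_anti, gfp_unfold.
Qed.

Section GreatestFixpoint.

Variables (L : term -> Prop) (Z : list frame -> Prop).
Let T := gfp L Z.
Let K := psi Z T.

Lemma gfp_red t t' : T t -> red t t' -> T t'.
Proof.
  intros Ht R. destruct (gfp_unfold Ht) as (S & HL & HM).
  apply gfp_fold; split; [|split].
  - apply S, R.
  - intros P RP; apply HL; econstructor; eassumption.
  - intros N H RN; apply HM; econstructor; eassumption.
Qed.

Lemma gfp_App p q : (forall t, red (App p q) t -> T t) -> T (App p q).
Proof.
  intros HR; apply gfp_fold; split; [|split].
  - constructor; intros t R; apply (gfp_unfold (HR _ R)).
  - intros P RP; inversion RP as [|t ? R R']; subst.
    apply (gfp_unfold (HR _ R)), R'.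
  - intros N H RN; inversion RN as [|t ? R R']; subst.
    apply (gfp_unfold (HR _ R)), R'.
Qed.

Lemma gfp_Mu N : (forall H, K H -> SN (minst H N)) -> T (Mu N).
Proof.
  intros HN; apply gfp_fold; split; [|split].
  (* The empty context belongs to [K]. *)
  - apply SN_Mu. apply (SN_inst_inv _ _ _ (HN [] (or_introl eq_refl))).
  - intros P RP; destruct (reds_Mu RP) as (? & E & _); discriminate E.
  - intros N' H RN HK; destruct (reds_Mu RN) as (? & E & R).
    injection E as <-. eapply SN_reds; [apply HN, HK | apply reds_inst, R].
Qed.

Lemma gfp_Lam M : SN M -> (forall P, reds M P -> L P) -> T (Lam M).
Proof.
  intros S HL; apply gfp_fold; split; [|split].
  - apply SN_Lam, S.
  - intros P RP; destruct (reds_Lam RP) as (? & E & R).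
    injection E as <-; auto.
  - intros N H RN; destruct (reds_Lam RN) as (? & E & _); discriminate E.
Qed.

Lemma gfp_Var x : T (Var x).
Proof.
  apply gfp_fold; split; [|split].
  - constructor; intros t R; inversion R.
  - intros P RP; discriminate (reds_Var RP).
  - intros N H RN; discriminate (reds_Var RN).
Qed.

Lemma gfp_Nam a M : SN M -> T (Nam a M).
Proof.
  intros S; apply gfp_fold; split; [|split].
  - apply SN_Nam, S.
  - intros P RP; destruct (reds_Nam RP) as (? & E); discriminate E.
  - intros N H RN; destruct (reds_Nam RN) as (? & E); discriminate E.
Qed.

Lemma arrow_red X Y s s' : arrow T X Y s -> red s s' -> arrow T X Y s'.
Proof.
  intros (S & HL & HM) R; split; [|split].
  - apply S, R.
  - intros u P Tu RP; apply HL; auto; econstructor; eassumption.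
  - intros u N H Tu RN; apply HM; auto; econstructor; eassumption.
Qed.

(** Nested induction on the strong normalization of [s] and [t], checking every reduct. Beta and mu
    redexes are covered by [arrow], mu' redexes by the membership of [t] in [T]. *)
Lemma arrow_App X Y s t : cand X Y -> arrow T X Y s -> T t -> X (App s t).
Proof.
  intros C As Tt.
  assert (Ss : SN s) by apply As.
  assert (St : SN t) by apply (gfp_unfold Tt).
  revert As t St Tt; induction Ss as [s _ IHs]; intros As t St.
  induction St as [t _ IHt]; intros Tt.
  apply (cand_App C); intros r R.
  inversion R as [M ? | M ? | ? M | | ? s' ? Rs | ? ? t' Rt | | ]; subst.
  - apply As; [exact Tt | constructor].
  - apply (cand_Mu C); intros H HY.
    rewrite msubst_r_inst.
    change (AppTo (shift_mu t)) with (fmap shift_mu (AppTo t)).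
    rewrite minst_cupd.
    apply As; [exact Tt | constructor | exact HY].
  - apply (cand_Mu C); intros H HY.
    rewrite msubst_l_inst.
    change (AppOf (shift_mu s)) with (fmap shift_mu (AppOf s)).
    rewrite minst_cupd.
    destruct (gfp_unfold Tt) as (_ & _ & HM).
    apply HM; [constructor|].
    (* [AppOf s :: H] is a legitimate test for [t], with [(X, Y)] itself as the quantified
       candidate. *)
    right; right; exists s, H, X, Y.
    repeat (split; [assumption || reflexivity|]).
    exact As.
  - apply IHs; auto.
    + eapply arrow_red; eassumption.
    + constructor; auto. intros t' Rt; apply (gfp_unfold Tt), Rt.
  - apply IHt; auto. eapply gfp_red; eassumption.
Qed.

(** Only contexts from [Z] remain to be checked: a left frame carries its own candidate, to which
    [arrow_App] applies. *)
Lemma gfp_cand :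
  (forall t H, T t -> Z H -> SN (plug H t)) -> cand T K.
Proof.
  intros HZ; split.
  - intros t H Tt [-> | [ZH | (s & H' & X & Y & -> & C & HY & As)]].
    + apply (gfp_unfold Tt).
    + auto.
    + apply (cand_plug C _ H' (arrow_App C As Tt) HY).
  - exact gfp_App.
  - exact gfp_Mu.
Qed.

End GreatestFixpoint.

(** Left frames being handled by [psi], these are the two clauses specific to
    an arrow type: the bodies of abstractions and the contexts [H[([] u)]]. *)
Definition arr_lams (T T' : term -> Prop) (P : term) : Prop :=
  forall u, T u -> T' (subst0 u P).
Definition arr_elims (T : term -> Prop) (K' : list frame -> Prop)
  (H : list frame) : Prop :=
  exists u H', H = AppTo u :: H' /\ T u /\ K' H'.

(** The two components are computed together because [gfp] at a subtype depends on both. At base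
    types abstractions are unconstrained and there are no specific contexts. *)
Fixpoint lams_elims (Atom : Type) (A : ty Atom) :
  (term -> Prop) * (list frame -> Prop) :=
  match A with
  | Arr A B =>
      let (LA, ZA) := lams_elims A in
      let (LB, ZB) := lams_elims B in
      (arr_lams (gfp LA ZA) (gfp LB ZB),
       arr_elims (gfp LA ZA) (psi ZB (gfp LB ZB)))
  | _ => (fun _ => True, fun _ => False)
  end.

Definition lams (Atom : Type) (A : ty Atom) := fst (lams_elims A).
Definition elims (Atom : Type) (A : ty Atom) := snd (lams_elims A).
Definition tm (Atom : Type) (A : ty Atom) := gfp (lams A) (elims A).
Definition ct (Atom : Type) (A : ty Atom) := psi (elims A) (tm A).

Lemma lams_Arr (Atom : Type) (A B : ty Atom) :
  lams (Arr A B) = arr_lams (tm A) (tm B).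
Proof.
  unfold tm, lams, elims; simpl.
  destruct (lams_elims A), (lams_elims B); reflexivity.
Qed.

Lemma elims_Arr (Atom : Type) (A B : ty Atom) :
  elims (Arr A B) = arr_elims (tm A) (ct B).
Proof.
  unfold ct, tm, lams, elims; simpl.
  destruct (lams_elims A), (lams_elims B); reflexivity.
Qed.

Lemma tm_arrow (Atom : Type) (A B : ty Atom) s :
  tm (Arr A B) s -> arrow (tm A) (tm B) (ct B) s.
Proof.
  intros Ts; destruct (gfp_unfold Ts) as (S & HL & HM).
  rewrite lams_Arr in HL. split; [exact S | split].
  - intros u P Tu RP; apply HL; assumption.
  - intros u N H Tu RN HK; apply HM; [assumption|].
    right; left; rewrite elims_Arr; exists u, H; auto.
Qed.

(** For a context [AppTo u :: H'], [arrow_App] puts the application in the codomain's candidate,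
    whose contexts include [H']. *)
Lemma tm_cand (Atom : Type) (A : ty Atom) : cand (tm A) (ct A).
Proof.
  induction A as [p | | A _ B IHB]; apply gfp_cand; try (intros t H _ []).
  intros t H Tt; rewrite elims_Arr; intros (u & H' & -> & Tu & HK).
  apply (cand_plug IHB (App t u) H'); [|exact HK].
  apply (arrow_App IHB (tm_arrow Tt) Tu).
Qed.

(** * Adequacy and strong normalization of typed terms *)

Lemma tm_reds (Atom : Type) (A : ty Atom) t t' : tm A t -> reds t t' -> tm A t'.
Proof.
  intros Tt R; induction R as [|t t1 t' R _ IH]; auto.
  apply IH; eapply gfp_red; eassumption.
Qed.

(** The target indices in [g] are left free: by [gfp_Nam], a named term asks only that its body be
    strongly normalizing. *)
Lemma adequacy (Atom : Type) (G D : ctx Atom) M A :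
  typed G D M A ->
  forall f g,
    (forall x B, G x = Some B -> tm B (f x)) ->
    (forall a B, D a = Some B -> ct B (snd (g a))) ->
    tm A (inst f g M).
Proof.
  induction 1 as [G D x A E | G D M A B _ IH | G D M N A B _ IHM _ IHN
                 | G D M A _ IH | G D a M A E _ IH]; intros f g Hf Hg; simpl.
  - apply Hf, E.
  - assert (HM : forall u, tm A u ->
      tm B (subst0 u (inst (up_lam f) (cup_lam g) M))).
    { intros u Tu.
      rewrite subst0_inst_up. apply IH; auto.
      intros [|x] C; simpl; intros E; auto. injection E as <-; exact Tu. }
    apply gfp_Lam.
    (* Variables lie in every [tm], so some instance of the body is strongly normalizing, and hence
       the body is. *)
    + specialize (HM (Var 0) (gfp_Var _ _ _)). unfold subst0 in HM.
      rewrite subst_inst in HM.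
      apply (SN_inst_inv _ _ _ (proj1 (gfp_unfold HM))).
    + rewrite lams_Arr; intros P R u Tu. apply (tm_reds (HM u Tu)).
      unfold subst0; rewrite !subst_inst; apply reds_inst, R.
  - apply (arrow_App (tm_cand B) (tm_arrow (IHM f g Hf Hg)) (IHN f g Hf Hg)).
  - apply gfp_Mu; intros H HK.
    (* Feeding [H] to the bound variable extends [g] by [(0, H)], so the induction hypothesis at
       [Bot] applies. *)
    rewrite minst_inst_up. apply (@gfp_unfold (lams (@Bot Atom)) (elims (@Bot Atom))).
    apply IH; auto.
    intros [|a] C; simpl; intros E; eauto. injection E as <-; exact HK.
  - apply gfp_Nam. apply (cand_plug (tm_cand A)); eauto.
Qed.

(** Adequacy is applied to the identity instantiation, which sends mu-variables to empty
    contexts. *)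
Lemma typed_SN (Atom : Type) (G D : ctx Atom) M A : typed G D M A -> SN M.
Proof.
  intros HM. rewrite <- (inst_id M). apply (@gfp_unfold (lams A) (elims A)).
  apply (adequacy HM).
  - intros x B _; apply gfp_Var.
  - intros a B _; left; reflexivity.
Qed.

Theorem theorem20 (Atom : Type) (G D : ctx Atom) (M : term) (A : ty Atom)
  (HM : typed G D M A) :
  ~ exists f : nat -> term, f 0 = M /\ forall n : nat, red (f n) (f (S n)).
Proof.
  intros (f & <- & Hf). pose proof (typed_SN HM) as S0.
  (* By accessibility, no strongly normalizing term occurs anywhere in the sequence. *)
  assert (Hn : forall t, SN t -> forall n, f n <> t).
  { induction 1 as [t _ IH]; intros n E; subst t.
    exact (IH _ (Hf n) _ eq_refl). }
  exact (Hn _ S0 0 eq_refl).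
Qed.
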